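(* Let $\mathcal{GO}$ be a bivariate general overlap function, let $N$ be a fuzzy negation, and let $I_{\mathcal{GO}}^{N}(x,y)=N(\mathcal{GO}(x,N(y)))$ for $x,y\in[0,1]$. Then: (i) $I_{\mathcal{GO}}^{N}$ satisfies L-CP($N$). (ii) If $N$ is strict, then $I_{\mathcal{GO}}^{N}$ satisfies R-CP($N^{-1}$). (iii) If $N$ is strict, $I_{\mathcal{GO}}^{N}$ satisfies R-CP($N$), and $1$ is the neutral element of $\mathcal{GO}$, then $N$ is a strong negation. (iv) If $N$ is a strong negation, then $I_{\mathcal{GO}}^{N}$ satisfies CP($N$). (v) If $N$ is strict, $I_{\mathcal{GO}}^{N}$ satisfies CP($N$), and $1$ is the neutral element of $\mathcal{GO}$, then $N$ is a strong negation.
   Context: A fuzzy negation is a map $N:[0,1]\to[0,1]$ with $N(0)=1$, $N(1)=0$ and $N(x)\le N(y)$ whenever $y\le x$. It is strict if it is continuous and $N(x)<N(y)$ whenever $y<x$; it is strong if $N(N(x))=x$ for all $x\in[0,1]$. A bivariate general overlap function is a function $\mathcal{GO}:[0,1]^2\to[0,1]$ such that for all $x,y\in[0,1]$: (1) $\mathcal{GO}(x,y)=\mathcal{GO}(y,x)$; (2) if $xy=0$ then $\mathcal{GO}(x,y)=0$; (3) if $xy=1$ then $\mathcal{GO}(x,y)=1$; (4) $\mathcal{GO}$ is increasing (in the non-strict sense) in each variable; (5) $\mathcal{GO}$ is continuous. An element $a\in[0,1]$ is a neutral element of $\mathcal{GO}$ if $\mathcal{GO}(x,a)=x$ for all $x\in[0,1]$.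 For $I:[0,1]^2\to[0,1]$ and a fuzzy negation $M$: $I$ satisfies CP($M$) if $I(x,y)=I(M(y),M(x))$ for all $x,y\in[0,1]$; $I$ satisfies L-CP($M$) if $I(M(x),y)=I(M(y),x)$ for all $x,y\in[0,1]$; $I$ satisfies R-CP($M$) if $I(x,M(y))=I(y,M(x))$ for all $x,y\in[0,1]$. *)

(* Defs.v *)
From HB Require Import structures.
From mathcomp Require Import all_boot all_order all_algebra.
From mathcomp Require Import all_classical all_reals all_analysis.
Set Implicit Arguments.
Unset Strict Implicit.
Unset Printing Implicit Defensive.
Import Order.TTheory GRing.Theory Num.Theory.
Import numFieldNormedType.Exports.
Local Open Scope classical_set_scope.
Local Open Scope ring_scope.

(* Maps on [0,1] are total functions on R of which only the restriction to
   [0,1] matters: every condition below is relativized to [0,1], and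
   continuity is for the subspace topology. *)
Definition unit_itv (R : realType) : set R := `[0, 1].
Arguments unit_itv {R}.

Definition fuzzy_negation (R : realType) (N : R -> R) : Prop :=
  [/\ set_fun unit_itv unit_itv N, N 0 = 1, N 1 = 0 &
      forall x y, unit_itv x -> unit_itv y -> y <= x -> N x <= N y].

Definition strict_negation (R : realType) (N : R -> R) : Prop :=
  [/\ fuzzy_negation N, {within unit_itv, continuous N} &
      forall x y, unit_itv x -> unit_itv y -> y < x -> N x < N y].

Definition strong_negation (R : realType) (N : R -> R) : Prop :=
  fuzzy_negation N /\ forall x, unit_itv x -> N (N x) = x.

Record general_overlap (R : realType) (GO : R -> R -> R) : Prop := {
  go_unit : forall x y, unit_itv x -> unit_itv y -> unit_itv (GO x y);
  go_sym : forall x y, unit_itv x -> unit_itv y -> GO x y = GO y x;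
  go_eq0 : forall x y, unit_itv x -> unit_itv y -> x * y = 0 -> GO x y = 0;
  go_eq1 : forall x y, unit_itv x -> unit_itv y -> x * y = 1 -> GO x y = 1;
  go_incl : forall x x' y, unit_itv x -> unit_itv x' -> unit_itv y ->
    x <= x' -> GO x y <= GO x' y;
  go_incr : forall x y y', unit_itv x -> unit_itv y -> unit_itv y' ->
    y <= y' -> GO x y <= GO x y';
  go_continuous :
    {within unit_itv `*` unit_itv, continuous (fun p : R * R => GO p.1 p.2)}
}.

Definition neutral_element (R : realType) (GO : R -> R -> R) (a : R) : Prop :=
  unit_itv a /\ forall x, unit_itv x -> GO x a = x.

Definition CP (R : realType) (I : R -> R -> R) (M : R -> R) : Prop :=
  forall x y, unit_itv x -> unit_itv y -> I x y = I (M y) (M x).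

Definition L_CP (R : realType) (I : R -> R -> R) (M : R -> R) : Prop :=
  forall x y, unit_itv x -> unit_itv y -> I (M x) y = I (M y) x.

Definition R_CP (R : realType) (I : R -> R -> R) (M : R -> R) : Prop :=
  forall x y, unit_itv x -> unit_itv y -> I x (M y) = I y (M x).

Definition GON_implication (R : realType) (GO : R -> R -> R) (N : R -> R) :
    R -> R -> R :=
  fun x y => N (GO x (N y)).

(* The inverse of N as a map of [0,1]; the next two lemmas show that it is a
   genuine two-sided inverse, and a fuzzy negation, when N is strict. *)
Definition negation_inv (R : realType) (N : R -> R) : R -> R :=
  pinv unit_itv N.

Lemma strict_negation_bij (R : realType) (N : R -> R) :
  strict_negation N -> set_bij unit_itv unit_itv N.
Proof.
move=> [[Nf N0 N1 _] Nc Nlt]; split=> //.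
- move=> x y /set_mem xU /set_mem yU Nxy; case: (ltgtP x y) => // xy.
  + by have := Nlt _ _ yU xU xy; rewrite Nxy ltxx.
  + by have := Nlt _ _ xU yU xy; rewrite Nxy ltxx.
- move=> v vU.
  have [] := @IVT R N 0 1 v ler01 Nc; last by move=> c cU <-; exists c.
  move: vU; rewrite /unit_itv /= in_itv /= N0 N1 => /andP[v0 v1].
  by rewrite minEle maxEle ler10 v0 v1.
Qed.

Lemma negation_invP (R : realType) (N : R -> R) : strict_negation N ->
  [/\ fuzzy_negation (negation_inv N),
      forall x, unit_itv x -> negation_inv N (N x) = x &
      forall x, unit_itv x -> N (negation_inv N x) = x].
Proof.
move=> Ns; have [Nf Ninj Nsurj] := strict_negation_bij Ns.
have [[_ N0 N1 _] _ Nlt] := Ns.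
have U0 : unit_itv (0 : R) by rewrite /unit_itv /= in_itv /= lexx ler01.
have U1 : unit_itv (1 : R) by rewrite /unit_itv /= in_itv /= lexx ler01.
have NK x : unit_itv x -> negation_inv N (N x) = x.
  by move=> /mem_set; exact: pinvKV.
have NVK x : unit_itv x -> N (negation_inv N x) = x.
  by move=> /mem_set; exact: surjpK.
have NVU x : unit_itv x -> unit_itv (negation_inv N x).
  by move=> /Nsurj[y yU <-]; rewrite NK.
split=> //; split=> //.
- by rewrite -[X in negation_inv N X]N1 NK.
- by rewrite -[X in negation_inv N X]N0 NK.
- move=> x y xU yU yx; rewrite leNgt; apply/negP => ltxy.
  by have := Nlt _ _ (NVU _ xU) (NVU _ yU) ltxy; rewrite !NVK// ltNge yx.
Qed.

(* Main.v *)
Require Import Defs.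
From mathcomp Require Import all_boot all_order all_algebra.
From mathcomp Require Import all_classical all_reals all_analysis.
Import Order.TTheory GRing.Theory Num.Theory.
Import numFieldNormedType.Exports.
Local Open Scope ring_scope.

(** Each contraposition law equates two values of the form [N (GO a b)], so
    everything rests on the symmetry of [GO].  For L-CP with [N], R-CP with the
    inverse of [N], and CP with a strong [N], the two sides become
    [N (GO a b)] and [N (GO b a)] once the compositions of [N] with its inverse
    (or with itself) are cancelled.

    Conversely, without such a cancellation R-CP and CP with [N] both compare
    [GO] at an argument [x] with [GO] at [N (N x)].  Choosing the other
    variable so that the remaining arguments are [1] and using that [1] is
    neutral leaves [N x = N (N (N x))]; a strict negation is injective on the
    unit interval, hence [N (N x) = x] ([strong_of_neutral_exchange]). *)

Lemma unit_itv0 (R : realType) : unit_itv (0 : R).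
Proof. by rewrite /unit_itv /= in_itv /= lexx ler01. Qed.

Lemma unit_itv1 (R : realType) : unit_itv (1 : R).
Proof. by rewrite /unit_itv /= in_itv /= lexx ler01. Qed.

(** The hypothesis is the instance that R-CP and CP share: R-CP with second
    variable [1], where [N (N 1) = 1], and CP with second variable [0], where
    [N 0 = 1]. *)
Lemma strong_of_neutral_exchange {R : realType} {GO : R -> R -> R}
    {N : R -> R} :
  general_overlap GO -> strict_negation N -> neutral_element GO 1 ->
  (forall x, unit_itv x -> N (GO x 1) = N (GO 1 (N (N x)))) ->
  strong_negation N.
Proof.
move=> hGO Ns [U1 GO1] exch; have [_ Ninj _] := strict_negation_bij Ns.
have [Nneg _ _] := Ns; have [NU _ _ _] := Nneg; split=> // x xU.
have NNxU : unit_itv (N (N x)) by apply/NU/NU.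
have := exch x xU; rewrite (go_sym hGO U1 NNxU) !GO1// => NxNNNx.
by apply/esym/Ninj => //; exact: mem_set.
Qed.

Theorem proposition13 (R : realType) (GO : R -> R -> R) (N : R -> R)
    (hGO : general_overlap GO) (hN : fuzzy_negation N) :
  L_CP (GON_implication GO N) N /\
  (strict_negation N -> R_CP (GON_implication GO N) (negation_inv N)) /\
  (strict_negation N -> R_CP (GON_implication GO N) N ->
    neutral_element GO 1 -> strong_negation N) /\
  (strong_negation N -> CP (GON_implication GO N) N) /\
  (strict_negation N -> CP (GON_implication GO N) N ->
    neutral_element GO 1 -> strong_negation N).
Proof.
have [NU N0 N1 _] := hN; rewrite /GON_implication.
split; [|split; [|split; [|split]]].
- by move=> x y xU yU; rewrite (go_sym hGO (NU _ xU) (NU _ yU)).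
- move=> Ns x y xU yU; have [_ _ NVK] := negation_invP Ns.
  by rewrite !NVK// (go_sym hGO xU yU).
- move=> Ns rcp neu; apply: (strong_of_neutral_exchange hGO Ns neu) => x xU.
  by have := rcp x 1 xU (unit_itv1 R); rewrite N1 N0.
- move=> [_ NK] x y xU yU.
  by rewrite NK// (go_sym hGO xU (NU _ yU)).
- move=> Ns cp neu; apply: (strong_of_neutral_exchange hGO Ns neu) => x xU.
  by have := cp x 0 xU (unit_itv0 R); rewrite N0.
Qed.
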